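(* Let $\mathcal H=H_*\oplus H_{**}$ be an orthogonal decomposition. Let $T:\mathcal H\rightrightarrows\mathcal H$ be maximal monotone with $\operatorname{zer}T\neq\emptyset$, and suppose the aligned semidefinite proximal scheme for $T$ is implementable relative to this splitting. For each $k\ge0$ let $c_k>0$ and let $B_k:\mathcal H\to\mathcal H$ be self-adjoint and positive semidefinite with common range $H_*$ and common kernel $H_{**}$, and let $B_{k,*}:=B_k|_{H_*}$. Suppose there exist $\alpha_k\ge1$ such that, for $k\ge1$, $$\alpha_k^{-1}\|u\|_{B_{k-1,*}}\le\|u\|_{B_{k,*}}\le\alpha_k\|u\|_{B_{k-1,*}}\qquad\forall\,u\in H_*,$$ with $\prod_{k=1}^\infty\alpha_k<\infty$, and $c_k\to c_\infty\in(0,+\infty]$. Let $\{z^k\}\subset\mathcal H$, $z^k=(z^k_*,z^k_{**})$, satisfy, for some $\varepsilon_k\in(0,1)$ with $\sum_k\varepsilon_k<\infty$, $$c_kd_k\le\varepsilon_k\min\{1,\|z_*^{k+1}-z_*^k\|_{B_{k,*}}\}\qquad\text{for all }k\ge0,$$ where $d_k:=\operatorname{dist}_{B_{k,*}^{-1}}\bigl(0,\mathcal R_{k,*}(z^{k+1})\bigr)$ and $$\mathcal R_{k,*}(z^{k+1}):=\{r_*\in H_*\mid(r_*,0)\in T(z^{k+1})+c_k^{-1}B_k(z^{k+1}-z^k)\}.$$ Let $B_{\infty,*}$ be the operator-norm limit of $\{B_{k,*}\}$ and let $\bar z_*=\lim_k z_*^k\in\operatorname{zer}T_*$ be the active limit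 (both limits exist under these hypotheses). Assume that $T_*$ is metrically subregular at $\bar z_*$ for $0$ in the $B_{\infty,*}$-metric. Then $\operatorname{dist}_{B_{\infty,*}}(z_*^k,\operatorname{zer}T_* )$ converges Q-linearly to $0$ at the rate $$r=\frac{a_\infty}{\sqrt{a_\infty^2+c_\infty^2}},\qquad\text{where }a_\infty:=\operatorname{subreg}_{B_{\infty,*}}(T_*;\bar z_*\mid0)<\infty,$$ and $r=0$ if $c_\infty=+\infty$.
   Context: $\mathcal H$ is a finite-dimensional Hilbert space; each $z\in\mathcal H$ is written $z=(z_*,z_{**})$ with $z_*\in H_*$, $z_{**}\in H_{**}$ its orthogonal components. $\operatorname{zer}F:=\{z\mid0\in F(z)\}$. The projected mapping $T_*:H_*\rightrightarrows H_*$ is defined by $w_*\in T_*(z_* )\iff\exists z_{**}\in H_{**}$ such that $(w_*,0)\in T(z_*,z_{**})$. A self-adjoint positive semidefinite linear operator $B:\mathcal H\to\mathcal H$ is aligned with the splitting if its range is $H_*$ and its kernel is $H_{**}$. The aligned semidefinite proximal scheme for $T$ is implementable relative to the splitting if, for every $c>0$, every aligned $B$ and every $x\in\mathcal H$, the inclusion $0\in T(z)+c^{-1}B(z-x)$ has at least one solution $z\in\mathcal H$. For a self-adjoint positive definite operator $G$, $\|u\|_G:=\sqrt{\langle Gu,u\rangle}$ and $\operatorname{dist}_G(x,C):=\inf_{v\in C}\|x-v\|_G$, with value $+\infty$ when $C=\emptyset$. The operators $B_{k,*}:H_*\to H_*$ are self-adjoint positive definite, and under the stated hypotheses they converge in operator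 norm to a self-adjoint positive definite operator $B_{\infty,*}$ on $H_*$. For $G\succ0$ on a finite-dimensional Hilbert space $X$, a mapping $F:X\rightrightarrows X$ is metrically subregular at $\bar x$ for $\bar y$ in the $G$-metric if there exist a neighborhood $N$ of $(\bar x,\bar y)\in\operatorname{gph}F$ and $a\in(0,+\infty)$ such that $$\operatorname{dist}_G\bigl(x,F^{-1}(\bar y)\bigr)\le a\|y-\bar y\|_{G^{-1}}\qquad\text{for every }(x,y)\in N\cap\operatorname{gph}F.$$ The infimum of all such local constants $a$ (over all neighborhoods) is denoted $\operatorname{subreg}_G(F;\bar x\mid\bar y)$. A nonnegative sequence $\{\delta_k\}$ converges Q-linearly to $0$ at the rate $r\in[0,1)$ if $\limsup_k\delta_{k+1}/\delta_k\le r$, in the sense that for every $\rho\in(r,1)$ one has $\delta_{k+1}\le\rho\,\delta_k$ for all sufficiently large $k$. *)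

(* Defs.v *)
From HB Require Import structures.
From mathcomp Require Import all_boot all_order all_algebra sesquilinear.
From mathcomp Require Import all_classical all_reals all_analysis.

Set Implicit Arguments.
Unset Strict Implicit.
Unset Printing Implicit Defensive.

Import Order.TTheory GRing.Theory Num.Theory.
Import numFieldNormedType.Exports.

Local Open Scope classical_set_scope.
Local Open Scope ring_scope.

Section InnerProductSpace.
Context {R : realType} {X : vectType R}.
(* The inner product of X; positive definiteness is only required of the forms
   at which these notions are instantiated. *)
Variable ip : X -> X -> R.

Definition ipnorm (u : X) : R := Num.sqrt (ip u u).

Definition Gnorm (G : 'End(X)) (u : X) : R := Num.sqrt (ip (G u) u).

(* [ereal_inf set0 = +oo], which is the convention for an empty [C]. *)
Definition Gdist (G : 'End(X)) (x : X) (C : set X) : \bar R :=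
  ereal_inf [set (Gnorm G (x - v))%:E | v in C].

Definition selfadjoint (A : 'End(X)) := forall u v, ip (A u) v = ip u (A v).

Definition possemidef (A : 'End(X)) :=
  selfadjoint A /\ forall u, 0 <= ip (A u) u.

Definition posdef (A : 'End(X)) :=
  selfadjoint A /\ forall u, u != 0 -> 0 < ip (A u) u.

Definition opnorm (A : 'End(X)) : \bar R :=
  ereal_sup [set (ipnorm (A u))%:E | u in [set u | ipnorm u <= 1]].

Definition cvg_ipnorm (x : nat -> X) (l : X) :=
  (fun k => ipnorm (x k - l)) @ \oo --> (0 : R).

Definition cvg_opnorm (A : nat -> 'End(X)) (L : 'End(X)) :=
  (fun k => opnorm (A k - L)) @ \oo --> (0%E : \bar R).

Definition zer (F : X -> set X) : set X := [set z | F z 0].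

Definition monotone (F : X -> set X) :=
  forall x y u v, F x u -> F y v -> 0 <= ip (u - v) (x - y).

Definition maximal_monotone (F : X -> set X) :=
  monotone F /\
  forall F' : X -> set X, monotone F' ->
    (forall x, F x `<=` F' x) -> forall x, F' x `<=` F x.

Definition nbhs_pair (p : X * X) (N : set (X * X)) :=
  exists2 e : R, 0 < e &
    forall x y, ipnorm (x - p.1) < e -> ipnorm (y - p.2) < e -> N (x, y).

Definition subreg_constant (G : 'End(X)) (F : X -> set X) (xb yb : X) (a : R) :=
  0 < a /\
  exists2 N : set (X * X), nbhs_pair (xb, yb) N &
    forall x y, N (x, y) -> F x y ->
      (Gdist G x [set x' | F x' yb] <= (a * Gnorm (G^-1)%VF (y - yb))%:E)%E.

Definition metrically_subregular (G : 'End(X)) (F : X -> set X) (xb yb : X) :=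
  F xb yb /\ exists a, subreg_constant G F xb yb a.

Definition subreg (G : 'End(X)) (F : X -> set X) (xb yb : X) : \bar R :=
  ereal_inf [set a%:E | a in subreg_constant G F xb yb].

End InnerProductSpace.

Section Splitting.
Context {R : realType} {V : vectType R}.
Variables (ip : V -> V -> R) (Hs Hss : {vspace V}).

Definition orthogonal_splitting :=
  (Hs + Hss = fullv)%VS /\ forall u v, u \in Hs -> v \in Hss -> ip u v = 0.

(* [daddv_pi Hs Hss] is the projection onto [Hs] along [Hss]. *)
Definition star (z : V) : subvs_of Hs := vsproj Hs (daddv_pi Hs Hss z).

Definition ip_star (u v : subvs_of Hs) : R := ip (vsval u) (vsval v).

(* [vsproj Hs] does not alter vectors of [Hs], so for [B] with range in [Hs]
   this is the restriction of [B] to [Hs]. *)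
Definition op_star (B : 'End(V)) : 'End(subvs_of Hs) :=
  linfun (vsproj Hs \o B \o vsval).

(* The pair (z_*, z_** ) is [vsval zs + vsval zss], and (w_*, 0) is [vsval ws]. *)
Definition map_star (T : V -> set V) (zs : subvs_of Hs) : set (subvs_of Hs) :=
  [set ws | exists zss : subvs_of Hss, T (vsval zs + vsval zss) (vsval ws)].

Definition aligned (B : 'End(V)) :=
  [/\ possemidef ip B, limg B = Hs & lker B = Hss].

Definition implementable (T : V -> set V) :=
  forall (c : R) (B : 'End(V)) (x : V), 0 < c -> aligned B ->
    exists z t, T z t /\ t + c^-1 *: B (z - x) = 0.

Definition residual_star (T : V -> set V) (c : R) (B : 'End(V)) (x z : V) :
    set (subvs_of Hs) :=
  [set r | exists2 t, T z t & vsval r = t + c^-1 *: B (z - x)].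

End Splitting.

Arguments star {R V} Hs Hss z.
Arguments ip_star {R V} ip Hs u v.
Arguments op_star {R V} Hs B.
Arguments map_star {R V} Hs Hss T zs.
Arguments residual_star {R V} Hs T c B x z.

(* Division-free form of [limsup delta_(k+1) / delta_k <= r]. *)
Definition Qlinear {R : realType} (delta : nat -> \bar R) (r : R) :=
  [/\ forall k, (0 <= delta k < +oo)%E,
      0 <= r < 1
    & forall rho : R, r < rho < 1 ->
        \forall k \near \oo, (delta k.+1 <= rho%:E * delta k)%E].

Definition rate {R : realType} (a : R) (c : \bar R) : R :=
  if c is c'%:E%E then a / Num.sqrt (a ^+ 2 + c' ^+ 2) else 0.

(* Main.v *)
(** Everything happens in [H_*]: orthogonality makes [T_*] monotone, and
implementability of the scheme says exactly that every proximal inclusion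
[c^-1 B_* (y - q) \in T_* q] is solvable, which replaces maximality of [T_*].

Let [p_k] be the exact proximal point of [z_k] in the metric [B_k]. Monotonicity
bounds the distance from [z_(k+1)] to [p_k] by [c_k d_k], and gives the
Pythagorean inequality [|p_k - v|^2 + |z_k - p_k|^2 <= |z_k - v|^2] for all zeros
[v]. With [P_k] the partial product of the [alpha_j], the norms [|u|_k / P_k]
decrease and [|u|_k P_k] increase, so the metrics converge by polarization and
are within the factor [P_oo / P_k -> 1] of their limit. Hence [z_k] is
quasi-Fejer, [z_k - p_k -> 0], every cluster point is a zero, and [z_k]
converges.

For large [k], subregularity with constant [a] bounds the distance from [p_k] to
the zeros by [(a / c_k) |z_k - p_k|] up to factors tending to [1]. Combined with
the Pythagorean inequality this contracts the distance by
[t / sqrt (1 + t^2)], [t = a / c_k], that is by [a / sqrt (a^2 + c_k^2)]; the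
relative error adds a term of order [eps_k] to the factor. *)

Require Import Defs.
From HB Require Import structures.
From mathcomp Require Import all_boot all_order all_algebra sesquilinear.
From mathcomp Require Import all_classical all_reals all_analysis.
From mathcomp Require Import ring lra.

Import Order.TTheory GRing.Theory Num.Theory.
Import numFieldNormedType.Exports.
Import VectorInternalTheory.

Local Open Scope classical_set_scope.
Local Open Scope ring_scope.

(** * Inner products and finite dimension *)

(** Definiteness is kept apart so that Cauchy-Schwarz is also available for the form of a merely
    positive semidefinite operator. *)
Record semi_inner {R : realType} {X : vectType R} (f : X -> X -> R) : Prop :=
  SemiInner {
    siC : forall u v, f u v = f v u;
    siZD : forall a u v w, f (a *: u + v) w = a * f u w + f v w;
    si_ge0 : forall u, 0 <= f u u }.

Definition inner_product {R : realType} {X : vectType R} (f : X -> X -> R) :=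
  semi_inner f /\ forall u, f u u = 0 -> u = 0.

Section SemiInnerTheory.
Context {R : realType} {X : vectType R} {f : X -> X -> R}.
Hypothesis hf : semi_inner f.
Implicit Types u v w : X.

Lemma siDl u v w : f (u + v) w = f u w + f v w.
Proof. by rewrite -{1}[u]scale1r (siZD _ hf) mul1r. Qed.

Lemma si0l w : f 0 w = 0.
Proof. by apply: (addrI (f 0 w)); rewrite -siDl !addr0. Qed.

Lemma siZl a u w : f (a *: u) w = a * f u w.
Proof. by rewrite -[a *: u]addr0 (siZD _ hf) si0l addr0. Qed.

Lemma siNl u w : f (- u) w = - f u w.
Proof. by rewrite -scaleN1r siZl mulN1r. Qed.

Lemma siBl u v w : f (u - v) w = f u w - f v w.
Proof. by rewrite siDl siNl. Qed.

Lemma siDr u v w : f w (u + v) = f w u + f w v.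
Proof. by rewrite (siC _ hf) siDl !(siC _ hf w). Qed.

Lemma siZr a u w : f w (a *: u) = a * f w u.
Proof. by rewrite (siC _ hf) siZl (siC _ hf w). Qed.

Lemma siNr u w : f w (- u) = - f w u.
Proof. by rewrite (siC _ hf) siNl (siC _ hf w). Qed.

Lemma siBr u v w : f w (u - v) = f w u - f w v.
Proof. by rewrite siDr siNr. Qed.

Lemma sqr_ipnorm u : ipnorm f u ^+ 2 = f u u.
Proof. by rewrite sqr_sqrtr ?(si_ge0 _ hf). Qed.

Lemma ipnorm_ge0 u : 0 <= ipnorm f u.
Proof. exact: sqrtr_ge0. Qed.

Lemma semi_inner_sqr_le u v : f u v ^+ 2 <= f u u * f v v.
Proof.
have expand t : 0 <= f u u - 2 * t * f u v + t ^+ 2 * f v v.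
  have := si_ge0 _ hf (u - t *: v).
  by rewrite !(siBl, siBr, siZl, siZr) (siC _ hf v u); lra.
have [vv0|vvN0] := eqVneq (f v v) 0.
  have [->|uvN0] := eqVneq (f u v) 0; first by rewrite vv0; lra.
  (* When [f v v = 0] the expansion is affine in [t]; this [t] makes it equal to [-1], a
     contradiction. *)
  have := expand ((f u u + 1) / (2 * f u v)); rewrite vv0.
  have -> : 2 * ((f u u + 1) / (2 * f u v)) * f u v = f u u + 1.
    by field.
  by lra.
have vv_gt0 : 0 < f v v by rewrite lt_def vvN0 (si_ge0 _ hf).
(* This [t] minimizes the quadratic. *)
have := expand (f u v / f v v).
have -> : f u u - 2 * (f u v / f v v) * f u v + (f u v / f v v) ^+ 2 * f v v
          = (f u u * f v v - f u v ^+ 2) / f v v by field.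
by rewrite pmulr_lge0 ?invr_gt0// subr_ge0.
Qed.

Lemma cauchy_schwarz u v : `|f u v| <= ipnorm f u * ipnorm f v.
Proof.
rewrite -(ler_pXn2r (n := 2)) ?nnegrE ?mulr_ge0 ?ipnorm_ge0//.
by rewrite real_normK ?num_real// exprMn !sqr_ipnorm semi_inner_sqr_le.
Qed.

Lemma cauchy_schwarz_le u v : f u v <= ipnorm f u * ipnorm f v.
Proof. exact: le_trans (ler_norm _) (cauchy_schwarz u v). Qed.

Lemma ler_ipnormD u v : ipnorm f (u + v) <= ipnorm f u + ipnorm f v.
Proof.
rewrite -(ler_pXn2r (n := 2)) ?nnegrE ?addr_ge0 ?ipnorm_ge0//.
rewrite sqrrD !sqr_ipnorm siDl !siDr (siC _ hf v u).
by have := cauchy_schwarz_le u v; lra.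
Qed.

Lemma ipnormZ a u : ipnorm f (a *: u) = `|a| * ipnorm f u.
Proof.
by rewrite /ipnorm siZl siZr mulrA sqrtrM ?sqr_ge0// sqrtr_sqr.
Qed.

Lemma ipnormN u : ipnorm f (- u) = ipnorm f u.
Proof. by rewrite /ipnorm siNl siNr opprK. Qed.

Lemma ipnorm0 : ipnorm f 0 = 0.
Proof. by rewrite /ipnorm si0l sqrtr0. Qed.

Lemma ipnorm_distC u v : ipnorm f (u - v) = ipnorm f (v - u).
Proof. by rewrite -ipnormN opprB. Qed.

Lemma ler_ipnorm_dist w u v :
  ipnorm f (u - v) <= ipnorm f (u - w) + ipnorm f (w - v).
Proof. by rewrite -{1}(subrKA w) ler_ipnormD. Qed.

Lemma ler_ipnorm_sum (I : finType) (x : I -> X) :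
  ipnorm f (\sum_i x i) <= \sum_i ipnorm f (x i).
Proof.
elim/big_ind2 : _ => [|y b z c yb zc|//]; first by rewrite ipnorm0.
by rewrite (le_trans (ler_ipnormD _ _))// lerD.
Qed.

Lemma polarization u v :
  f u v = (ipnorm f (u + v) ^+ 2 - ipnorm f (u - v) ^+ 2) / 4.
Proof.
rewrite !sqr_ipnorm !(siDl, siDr, siNl, siNr) (siC _ hf v u).
by field.
Qed.

End SemiInnerTheory.

(** * Coordinates, comparison of norms, and compactness *)

Section FiniteDimension.
Context {R : realType} {X : vectType R} {f : X -> X -> R}.
Hypothesis hf : inner_product f.
Let sf : semi_inner f := hf.1.

Local Notation n := (dim X).
Local Notation vb i := (r2v (delta_mx 0 i) : X).

Lemma vect_expansion (u : X) : u = \sum_i v2r u 0 i *: (vb i).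
Proof.
rewrite -{1}[u]v2rK [v2r u in LHS]row_sum_delta linear_sum.
by apply: eq_bigr => i _; rewrite linearZ.
Qed.

(* The coordinates of [u] are recovered from the numbers [f u (vb j)] by the
   inverse of the Gram matrix. *)
Lemma gram_inverse : exists W : 'M[R]_n, forall (u : X) i,
  v2r u 0 i = \sum_j f u (vb j) * W j i.
Proof.
pose G := \matrix_(i < n, j < n) f (vb i) (vb j).
have mulG u : v2r u *m G = \row_j f u (vb j).
  apply/rowP => j; rewrite !mxE {2}[u]vect_expansion.
  pose g w := f w (vb j).
  have g0 : g 0 = 0 by exact: si0l.
  have gD v w : g (v + w) = g v + g w by exact: siDl.
  rewrite -/(g _) (big_morph g gD g0); apply: eq_bigr => i _.
  by rewrite mxE /g siZl.
have Gfree : row_free G.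
  apply: inj_row_free => v; rewrite -[v]r2vK mulG => fv0.
  have {}fv0 j : f (r2v v) (vb j) = 0 by have /rowP/(_ j) := fv0; rewrite !mxE.
  rewrite (_ : r2v v = 0) ?linear0//; apply: hf.2.
  rewrite {2}[r2v v]vect_expansion.
  elim/big_ind : _ => [|x y x0 y0|i _].
  - by rewrite siC// si0l.
  - by rewrite siDr// x0 y0 addr0.
  - by rewrite siZr// fv0 mulr0.
exists (invmx G) => u i.
have -> : v2r u = (\row_j f u (vb j)) *m invmx G.
  by rewrite -mulG mulmxK// -row_free_unit.
by rewrite mxE; apply: eq_bigr => j _; rewrite mxE.
Qed.

(** By [gram_inverse] each coordinate is a fixed combination of the numbers [f u (vb j)], which
    Cauchy-Schwarz bounds. Summing over all [i] gives one constant for all coordinates, and the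
    added [1] keeps it positive. *)
Lemma coord_bound : exists2 K : R, 0 < K &
  forall (u : X) i, `|v2r u 0 i| <= K * ipnorm f u.
Proof.
have [W WP] := gram_inverse.
exists (1 + \sum_i \sum_j ipnorm f (vb j) * `|W j i|).
  rewrite ltr_pwDl// sumr_ge0// => i _; rewrite sumr_ge0// => j _.
  by rewrite mulr_ge0 ?ipnorm_ge0.
move=> u i; rewrite WP (le_trans (ler_norm_sum _ _ _))//.
rewrite (@le_trans _ _ ((\sum_j ipnorm f (vb j) * `|W j i|) * ipnorm f u))//.
  rewrite mulr_suml; apply: ler_sum => j _.
  rewrite normrM mulrAC ler_wpM2r//.
  by rewrite (le_trans (cauchy_schwarz _ _ _))// mulrC.
rewrite ler_wpM2r ?ipnorm_ge0// [X in _ <= _ + X](bigD1 i)//=.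
rewrite addrCA lerDl addr_ge0//.
by rewrite sumr_ge0// => k _; rewrite sumr_ge0// => j _;
  rewrite mulr_ge0 ?ipnorm_ge0.
Qed.

(** [K] is chosen before the seminorm [N], so the bound stays uniform when [N] varies with an
    operator. *)
Lemma seminorm_bound : exists2 K : R, 0 < K & forall N : X -> R,
  (forall u, 0 <= N u) -> (forall u v, N (u + v) <= N u + N v) ->
  (forall a u, N (a *: u) = `|a| * N u) ->
  forall u, N u <= K * (\sum_i N (vb i)) * ipnorm f u.
Proof.
have [K K0 KP] := coord_bound; exists K => // N N0 ND NZ u.
have N00 : N 0 = 0 by rewrite -(scale0r (0 : X)) NZ normr0 mul0r.
rewrite {1}[u]vect_expansion.
rewrite (@le_trans _ _ (\sum_i N (v2r u 0 i *: (vb i))))//.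
  elim/big_ind2 : _ => [|x a y b xa yb|//]; first by rewrite N00.
  by rewrite (le_trans (ND _ _))// lerD.
rewrite mulrAC mulr_sumr; apply: ler_sum => i _.
by rewrite NZ ler_wpM2r.
Qed.

Lemma ipnorm_dominated (g : X -> X -> R) : semi_inner g ->
  exists2 K : R, 0 < K & forall u, ipnorm g u <= K * ipnorm f u.
Proof.
move=> sg; have [K K0 KP] := seminorm_bound.
exists (K * (\sum_i ipnorm g (vb i)) + 1).
  by rewrite ltr_wpDl// mulr_ge0 ?sumr_ge0 ?ltW// => i _; exact: ipnorm_ge0.
move=> u; rewrite (le_trans (KP (ipnorm g) _ _ _ u))//.
- exact: ipnorm_ge0.
- exact: ler_ipnormD.
- exact: ipnormZ.
- by rewrite ler_wpM2r ?ipnorm_ge0// lerDl.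
Qed.

Lemma operator_bound : exists2 K : R, 0 < K & forall (A : 'End(X)) u,
  ipnorm f (A u) <= K * (\sum_i ipnorm f (A (vb i))) * ipnorm f u.
Proof.
have [K K0 KP] := seminorm_bound; exists K => // A u.
apply: (KP (fun u => ipnorm f (A u))).
- by move=> v; exact: ipnorm_ge0.
- by move=> v w; rewrite linearD ler_ipnormD.
- by move=> a v; rewrite linearZ ipnormZ.
Qed.

(** Bolzano-Weierstrass, from compactness of a box of coordinates. The cluster point is described by
    infinitely many close terms, which avoids extracting a subsequence. *)
Lemma bounded_frequently_near (x : nat -> X) (C : R) :
  (forall k, ipnorm f (x k) <= C) ->
  exists l, forall e, 0 < e -> forall N, exists2 k, (N <= k)%N &
    ipnorm f (x k - l) < e.
Proof.
move=> xC; have [K K0 KP] := coord_bound.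
pose A := [set v : 'rV[R]_n | forall i, `[- (K * C), K * C]%classic (v ord0 i)].
have cptA : compact A.
  apply: (@rV_compact _ _ (fun=> `[- (K * C), K * C]%classic)) => i.
  exact: segment_compact.
have xA k : A (v2r (x k)).
  move=> i /=; rewrite in_itv /= -ler_norml.
  by rewrite (le_trans (KP _ _))// ler_wpM2l// ltW.
have [|a [_ aC]] := cptA ((fun k => v2r (x k)) @ \oo) _.
  by exists 0%N => // k _; exact: xA.
pose S := \sum_i ipnorm f (vb i).
have S0 : 0 <= S by rewrite sumr_ge0// => i _; exact: ipnorm_ge0.
exists (r2v a) => e e0 N.
(* Coordinates within [e / (S + 1)] give a norm of at most [e / (S + 1) * S], which is below [e]
   even if [S = 0]. *)
have d0 : 0 < e / (S + 1) by rewrite divr_gt0// ltr_wpDl.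
have [|_ [[j Nj <-] [_ ak]]] := aC [set v2r (x k) | k in [set k | (N <= k)%N]]
  _ _ (nbhsx_ballx a _ d0).
  by exists N => // k Nk; exists k.
exists j => //.
rewrite [_ - _]vect_expansion (@le_lt_trans _ _ (e / (S + 1) * S))//.
  apply: le_trans; first exact: ler_ipnorm_sum.
  rewrite mulr_sumr; apply: ler_sum => i _.
  rewrite ipnormZ// ler_wpM2r ?ipnorm_ge0// linearB /= r2vK !mxE distrC ltW//.
  exact: ak.
by rewrite mulrAC ltr_pdivrMr ?ltr_wpDl// mulrDr mulr1 ltrDl.
Qed.

End FiniteDimension.

(** * Convergence of operators *)

Lemma cvg_sumr {R : realType} (I : finType) (F : I -> nat -> R) (a : I -> R) :
  (forall i, F i k @[k --> \oo] --> a i) ->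
  (\sum_i F i k) @[k --> \oo] --> \sum_i a i.
Proof.
by move=> Fa; apply: cvg_big => //; exact: add_continuous.
Qed.

Lemma cvg_sumr0 {R : realType} (I : finType) (F : I -> nat -> R) :
  (forall i, F i k @[k --> \oo] --> 0) ->
  (\sum_i F i k) @[k --> \oo] --> 0.
Proof. by move=> /cvg_sumr; rewrite big1. Qed.

Lemma squeeze_cvg0 {R : realType} {f g : nat -> R} :
  (forall k, 0 <= f k <= g k) -> g k @[k --> \oo] --> 0 ->
  f k @[k --> \oo] --> 0.
Proof.
by move=> fg; apply: (squeeze_cvgr (f := fun=> 0));
  [exact: nearW|exact: cvg_cst].
Qed.

Section OperatorConvergence.
Context {R : realType} {X : vectType R} {f : X -> X -> R}.
Hypothesis hf : inner_product f.
Let sf : semi_inner f := hf.1.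
Variables (A : nat -> 'End(X)).

Local Notation vb i := (r2v (delta_mx 0 i) : X).

Lemma lfun_mx (D : 'End(X)) u : D u = r2v (v2r u *m f2mx D).
Proof. by rewrite unlock. Qed.

Lemma opnorm_ge0 (D : 'End(X)) : (0 <= opnorm f D)%E.
Proof.
apply: ereal_sup_ubound; exists 0; rewrite /= ?ipnorm0// linear0 ipnorm0//.
Qed.

Lemma cvg_opnorm_ptwise L u : cvg_opnorm f A L ->
  ipnorm f (A k u - L u) @[k --> \oo] --> 0.
Proof.
(* The [+ 1] makes [s] positive even for [u = 0], and [s^-1 *: u] lies in the unit ball. *)
move=> AL; pose s := ipnorm f u + 1.
have s0 : 0 < s by rewrite ltr_wpDl ?ipnorm_ge0.
have : (fine \o (fun k => (ipnorm f (A k (s^-1 *: u) - L (s^-1 *: u)))%:E)) k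
    @[k --> \oo] --> 0.
  apply: fine_cvg; apply: squeeze_cvge (cvg_cst 0%E) AL.
  apply: nearW => k; rewrite lee_fin ipnorm_ge0/=.
  apply: ereal_sup_ubound; exists (s^-1 *: u).
    rewrite /= ipnormZ// gtr0_norm ?invr_gt0// mulrC ler_pdivrMr// mul1r.
    by rewrite lerDl.
  by rewrite add_lfunE opp_lfunE.
move=> /(cvgMr_tmp (b := s)); rewrite mul0r; apply: cvg_trans.
apply: near_eq_cvg; apply: nearW => k /=.
rewrite !linearZ/= -scalerDr ipnormZ// gtr0_norm ?invr_gt0// mulrAC.
rewrite mulVf ?mul1r//.
by rewrite gt_eqF.
Qed.

Lemma cvg_opnorm_form L u v : cvg_opnorm f A L ->
  f (A k u) v @[k --> \oo] --> f (L u) v.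
Proof.
move=> AL; apply/subr_cvg0.
suff : `|f (A k u) v - f (L u) v| @[k --> \oo] --> (0 : R).
  exact: norm_cvg0.
apply: (squeeze_cvg0 (g := fun k => ipnorm f (A k u - L u) * ipnorm f v)).
  by move=> k; rewrite normr_ge0/= -(siBl sf) cauchy_schwarz.
rewrite -(mul0r (ipnorm f v)); apply: cvgMr_tmp.
exact: cvg_opnorm_ptwise.
Qed.

(** By [operator_bound], the operator norm of [A k - L] is controlled by its values on the finitely
    many basis vectors. *)
Lemma cvg_opnorm_basis (L : 'End(X)) :
  (forall i, ipnorm f (A k (vb i) - L (vb i)) @[k --> \oo] --> 0) ->
  cvg_opnorm f A L.
Proof.
move=> AL; have [K K0 KP] := operator_bound hf.
pose b k := K * \sum_i ipnorm f ((A k - L) (vb i)).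
have b0 : b k @[k --> \oo] --> 0.
  rewrite -(mulr0 K); apply: cvgMl_tmp.
  apply: cvg_sumr0 => i; apply: cvg_trans (AL i).
  by apply: near_eq_cvg; apply: nearW => k; rewrite add_lfunE opp_lfunE.
apply: (squeeze_cvge (f := fun=> 0%E) (h := EFin \o b)).
- apply: nearW => k; rewrite opnorm_ge0/=; apply: ge_ereal_sup => _ [u u1 <-].
  rewrite lee_fin (le_trans (KP _ _))// ler_piMr// mulr_ge0 ?(ltW K0)//.
  by rewrite sumr_ge0// => i _; exact: ipnorm_ge0.
- exact: cvg_cst.
- by apply: cvg_EFin => //; exact: nearW.
Qed.

Lemma cvg_opnorm_exists : (forall u v, cvgn (fun k => f (A k u) v)) ->
  exists L, cvg_opnorm f A L.
Proof.
move=> Acv; have [W WP] := gram_inverse hf.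
(* Row [i] holds the limits of the coordinates of [A k (vb i)], which the inverse Gram matrix
   computes from the convergent numbers [f (A k (vb i)) (vb l)]. *)
pose L : 'End(X) := Hom (\matrix_(i < dim X, j < dim X)
  \sum_l limn (fun k => f (A k (vb i)) (vb l)) * W l j).
have LE i j : v2r (L (vb i)) 0 j
    = \sum_l limn (fun k => f (A k (vb i)) (vb l)) * W l j.
  by rewrite lfun_mx !r2vK -rowE !mxE.
exists L; apply: cvg_opnorm_basis => i.
have coordL j : `|v2r (A k (vb i)) 0 j - v2r (L (vb i)) 0 j|
    @[k --> \oo] --> (0 : R).
  suff /subr_cvg0/cvg_norm :
      v2r (A k (vb i)) 0 j @[k --> \oo] --> v2r (L (vb i)) 0 j.
    by rewrite normr0.
  rewrite LE; under eq_fun do rewrite WP.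
  by apply: cvg_sumr => l; apply: cvgMr_tmp; exact: Acv.
apply: (squeeze_cvg0 (g := fun k =>
  \sum_j `|v2r (A k (vb i)) 0 j - v2r (L (vb i)) 0 j| * ipnorm f (vb j))).
  move=> k; rewrite ipnorm_ge0/= {1}[_ - _]vect_expansion.
  apply: le_trans; first exact: ler_ipnorm_sum. apply: ler_sum => j _.
  by rewrite ipnormZ// linearB/= !mxE.
by apply: cvg_sumr0 => j; rewrite -(mul0r (ipnorm f (vb j))); apply: cvgMr_tmp.
Qed.

End OperatorConvergence.

(** * The scalar contraction factor *)

Section SubregularProximalRate.
Context {R : realType}.
Implicit Types a b c t rho : R.

(** This is the sine of the arctangent of [t]; for [c > 0], its value at [a / c] is
    [a / Num.sqrt (a ^+ 2 + c ^+ 2)]. *)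
Definition contraction t : R := t / Num.sqrt (1 + t ^+ 2).

(** The threshold [rho / Num.sqrt (1 - rho ^+ 2)] is the tangent of the arcsine of [rho], the
    preimage of [rho] under [contraction]. *)
Lemma contraction_lt t rho : 0 <= t -> 0 < rho < 1 ->
  t < rho / Num.sqrt (1 - rho ^+ 2) -> contraction t < rho.
Proof.
move=> t0 /andP[rho0 rho1].
have r2 : 0 < 1 - rho ^+ 2 by rewrite subr_gt0 expr_lt1// ltW.
rewrite ltr_pdivlMr ?sqrtr_gt0// => lt1.
have t1 : 0 < 1 + t ^+ 2 by rewrite ltr_pwDl ?sqr_ge0.
rewrite ltr_pdivrMr ?sqrtr_gt0//.
rewrite -(ltr_pXn2r (n := 2)) ?nnegrE ?mulr_ge0 ?sqrtr_ge0 ?(ltW rho0)//.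
rewrite exprMn sqr_sqrtr ?ltW//.
have : (t * Num.sqrt (1 - rho ^+ 2)) ^+ 2 < rho ^+ 2.
  by rewrite ltr_pXn2r ?nnegrE ?mulr_ge0 ?sqrtr_ge0 ?(ltW rho0).
by rewrite exprMn sqr_sqrtr ?ltW//; lra.
Qed.

Lemma contraction_cvg (t : nat -> R) l : t k @[k --> \oo] --> l ->
  contraction (t k) @[k --> \oo] --> contraction l.
Proof.
move=> tl; apply: cvgM => //; apply: cvgV.
  by rewrite gt_eqF// sqrtr_gt0 ltr_pwDl ?sqr_ge0.
apply: continuous_cvg; first exact: sqrt_continuous.
apply: cvgD; first exact: cvg_cst.
by rewrite expr2; under eq_fun do rewrite expr2; exact: cvgM.
Qed.

(** Adding [D ^+ 2 <= b ^+ 2 * n ^+ 2] to [b ^+ 2] times the Pythagorean inequality gives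
    [(1 + b ^+ 2) * D ^+ 2 <= b ^+ 2 * E ^+ 2]. *)
Lemma le_contraction (D n E b : R) : 0 <= D -> 0 <= E -> 0 <= n -> 0 <= b ->
  D <= b * n -> D ^+ 2 + n ^+ 2 <= E ^+ 2 -> D <= contraction b * E.
Proof.
move=> D0 E0 n0 b0 Dbn DnE.
have b1 : 0 < 1 + b ^+ 2 by rewrite ltr_pwDl ?sqr_ge0.
rewrite /contraction mulrAC ler_pdivlMr ?sqrtr_gt0//.
rewrite -(ler_pXn2r (n := 2)) ?nnegrE ?mulr_ge0 ?sqrtr_ge0//.
rewrite exprMn sqr_sqrtr ?(ltW b1)// exprMn.
have D2 : D ^+ 2 <= b ^+ 2 * n ^+ 2 by rewrite -exprMn ler_pXn2r ?nnegrE ?mulr_ge0.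
have : b ^+ 2 * (D ^+ 2 + n ^+ 2) <= b ^+ 2 * E ^+ 2 by rewrite ler_wpM2l ?sqr_ge0.
by lra.
Qed.

Lemma rate_bounds a (c : \bar R) : 0 <= a -> (0 < c)%E -> 0 <= rate a c < 1.
Proof.
case: c => [c| |] a0 //; rewrite ?lexx ?ltr01// lte_fin => c0 /=.
have c2 : 0 < c ^+ 2 by rewrite exprn_gt0.
have ac : 0 < a ^+ 2 + c ^+ 2 by rewrite ltr_wpDl ?sqr_ge0.
rewrite divr_ge0 ?sqrtr_ge0//= ltr_pdivrMr ?sqrtr_gt0// mul1r.
rewrite -(ltr_pXn2r (n := 2)) ?nnegrE ?sqrtr_ge0//.
by rewrite sqr_sqrtr ?(ltW ac)// ltrDl.
Qed.

(** A real [c'] strictly below the limit lets finite and infinite limits be treated alike: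
    eventually [c'] bounds the parameters from below, and [a / c'] still contracts by less than
    [rho]. *)
Lemma rate_threshold a (c : \bar R) rho : 0 <= a -> (0 < c)%E ->
  rate a c < rho < 1 -> exists c' : R, [/\ 0 < c', (c'%:E < c)%E &
    a < rho / Num.sqrt (1 - rho ^+ 2) * c'].
Proof.
move=> a0 c0 /andP[rrho rho1].
have rho0 : 0 < rho.
  by apply: le_lt_trans rrho; case/andP: (rate_bounds _ _ a0 c0).
have r2 : 0 < 1 - rho ^+ 2 by rewrite subr_gt0 expr_lt1// ltW.
set tau := rho / _; have tau0 : 0 < tau by rewrite divr_gt0 ?sqrtr_gt0.
have at0 : 0 <= a / tau by rewrite divr_ge0// ltW.
case: c c0 rrho => [c| |]// c0 rrho; last first.
  exists (a / tau + 1); rewrite ltr_wpDl// ltry (mulrC tau).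
  by split; rewrite // -ltr_pdivrMr// ltrDl.
rewrite lte_fin in c0; rewrite /= in rrho.
have c2 : 0 < c ^+ 2 by rewrite exprn_gt0.
have ac : 0 < a ^+ 2 + c ^+ 2 by rewrite ltr_wpDl ?sqr_ge0.
have atc : a / tau < c.
  rewrite ltr_pdivrMr// mulrA ltr_pdivlMr ?sqrtr_gt0//.
  rewrite -(ltr_pXn2r (n := 2)) ?nnegrE ?mulr_ge0 ?sqrtr_ge0 ?(ltW rho0) ?(ltW c0)//.
  move: rrho; rewrite ltr_pdivrMr ?sqrtr_gt0// => rrho.
  have : a ^+ 2 < (rho * Num.sqrt (a ^+ 2 + c ^+ 2)) ^+ 2.
    by rewrite ltr_pXn2r ?nnegrE ?mulr_ge0 ?sqrtr_ge0 ?(ltW rho0).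
  by rewrite !exprMn !sqr_sqrtr ?ltW//; lra.
(* Any point strictly between [a / tau] and [c] would do; the midpoint is taken. *)
exists ((a / tau + c) / 2); rewrite lte_fin.
have -> : (a < tau * ((a / tau + c) / 2)) = (a / tau < (a / tau + c) / 2).
  by rewrite (mulrC tau) -ltr_pdivrMr.
by move: (a / tau) at0 atc => s s0 sc; split; lra.
Qed.

End SubregularProximalRate.

(** * Convergent metrics *)

Section Operators.
Context {R : realType} {X : vectType R} {ip : X -> X -> R}.
Hypothesis hip : inner_product ip.
Let sip : semi_inner ip := hip.1.

Lemma possemidef_semi_inner (G : 'End(X)) :
  possemidef ip G -> semi_inner (fun u v => ip (G u) v).
Proof.
move=> [Gsa G0]; split => // [u v|a u v w].
- by rewrite Gsa (siC _ sip).
- by rewrite linearP (siZD _ sip).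
Qed.

Lemma posdef_inner_product (G : 'End(X)) :
  posdef ip G -> inner_product (fun u v => ip (G u) v).
Proof.
move=> [Gsa G0]; split.
  apply: possemidef_semi_inner; split => // u.
  by have [->|/G0/ltW//] := eqVneq u 0; rewrite linear0 si0l.
by move=> u Gu0; apply/eqP; apply/negPn/negP => /G0; rewrite Gu0 ltxx.
Qed.

Lemma posdef_invK (G : 'End(X)) : posdef ip G -> cancel (G^-1)%VF G.
Proof.
move=> [_ G0]; apply: lker0_lfunVK; apply/lker0P => u v Guv.
apply/eqP; rewrite -subr_eq0; apply/negPn/negP => /G0.
by rewrite linearB /= Guv subrr si0l// ltxx.
Qed.

Lemma Gnorm_inv (G : 'End(X)) w : posdef ip G ->
  Gnorm ip (G^-1)%VF w = Gnorm ip G ((G^-1)%VF w).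
Proof. by move=> Gp; rewrite /Gnorm posdef_invK// (siC _ sip). Qed.

Lemma dual_pairing (G : 'End(X)) r v : posdef ip G ->
  ip r v <= Gnorm ip (G^-1)%VF r * Gnorm ip G v.
Proof.
move=> Gp; rewrite Gnorm_inv// -{1}(posdef_invK _ Gp r).
exact: (cauchy_schwarz_le (posdef_inner_product _ Gp).1).
Qed.

(** For [u], the image of [H y] under the inverse of [G], the squared [G]-norm of [u] is
    [ip (H y) u]. Cauchy-Schwarz in the [H]-metric and the comparison of norms bound it by [l] times
    the [H]-norm of [y] times the [G]-norm of [u]; one factor cancels. *)
Lemma dual_norm_image (G H : 'End(X)) (l : R) y : posdef ip G -> posdef ip H ->
  0 <= l -> (forall u, Gnorm ip H u <= l * Gnorm ip G u) ->
  Gnorm ip (G^-1)%VF (H y) <= l * Gnorm ip H y.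
Proof.
move=> Gp Hp l0 HG; rewrite Gnorm_inv//; set u := _ (H y).
have [-> |uN0] := eqVneq (Gnorm ip G u) 0; first by rewrite mulr_ge0 ?sqrtr_ge0.
have u_gt0 : 0 < Gnorm ip G u by rewrite lt_def uN0 sqrtr_ge0.
rewrite -(ler_pM2r u_gt0) -expr2.
rewrite (sqr_ipnorm (posdef_inner_product _ Gp).1) posdef_invK//.
rewrite (le_trans (cauchy_schwarz_le (posdef_inner_product _ Hp).1 y u))//.
by rewrite [leRHS]mulrAC [leRHS]mulrC ler_wpM2l ?sqrtr_ge0 ?HG.
Qed.

End Operators.

(** * Metrics whose successive ratios have a convergent product *)

Section VariableMetric.
Context {R : realType} {X : vectType R} {ip : X -> X -> R}.
Hypothesis hip : inner_product ip.
Let sip : semi_inner ip := hip.1.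
Context {M : nat -> 'End(X)} {alpha : nat -> R}.
Hypothesis M_pd : forall k, posdef ip (M k).
Hypothesis alpha_ge1 : forall k, (1 <= k)%N -> 1 <= alpha k.
Hypothesis M_ratio : forall k, (1 <= k)%N -> forall u : X,
  (alpha k)^-1 * Gnorm ip (M k.-1) u <= Gnorm ip (M k) u
    <= alpha k * Gnorm ip (M k.-1) u.

Local Notation P n := (\prod_(1 <= k < n.+1) alpha k).
Local Notation Pinf := (limn (fun n => P n)).
Hypothesis P_cvg : cvgn (fun n => P n).

Lemma metric_ip k : inner_product (fun u v => ip (M k u) v).
Proof. exact: posdef_inner_product. Qed.

Lemma Gnorm_ge0 (G : 'End(X)) u : 0 <= Gnorm ip G u.
Proof. exact: sqrtr_ge0. Qed.

Lemma alpha_prodS n : P n.+1 = P n * alpha n.+1.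
Proof. by rewrite big_nat_recr. Qed.

Lemma alpha_prod_ge1 n : 1 <= P n.
Proof.
elim: n => [|n IH]; first by rewrite big_nil.
by rewrite alpha_prodS (le_trans IH)// ler_peMr ?alpha_ge1// (le_trans ler01).
Qed.

Lemma alpha_prod_gt0 n : 0 < P n.
Proof. exact: lt_le_trans (alpha_prod_ge1 n). Qed.

Lemma alpha_prod_nondecreasing :
  {homo (fun n => P n) : n m / (n <= m)%N >-> n <= m}.
Proof.
apply/nondecreasing_seqP => n.
by rewrite alpha_prodS ler_peMr ?alpha_ge1// ltW ?alpha_prod_gt0.
Qed.

Lemma alpha_prod_le n : P n <= Pinf.
Proof. exact: (nondecreasing_cvgn_le alpha_prod_nondecreasing P_cvg). Qed.

Lemma Pinf_gt0 : 0 < Pinf.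
Proof. exact: lt_le_trans (alpha_prod_gt0 0) (alpha_prod_le 0). Qed.

Lemma alpha_gt0 k : 0 < alpha k.+1.
Proof. exact: lt_le_trans (alpha_ge1 _ _). Qed.

Lemma metric_le_next k u : Gnorm ip (M k) u <= alpha k.+1 * Gnorm ip (M k.+1) u.
Proof.
have /andP[+ _] := M_ratio k.+1 isT u.
by rewrite mulrC ler_pdivrMr ?alpha_gt0// mulrC.
Qed.

Lemma metric_next_le k u : Gnorm ip (M k.+1) u <= alpha k.+1 * Gnorm ip (M k) u.
Proof. by have /andP[] := M_ratio k.+1 isT u. Qed.

Lemma metric_div_nonincreasing u :
  {homo (fun k => Gnorm ip (M k) u / P k) : n m / (n <= m)%N >-> m <= n}.
Proof.
apply/nonincreasing_seqP => k.
rewrite ler_pdivrMr ?alpha_prod_gt0// alpha_prodS mulrA.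
rewrite divfK ?gt_eqF ?alpha_prod_gt0//.
by rewrite mulrC metric_next_le.
Qed.

Lemma metric_mul_nondecreasing u :
  {homo (fun k => Gnorm ip (M k) u * P k) : n m / (n <= m)%N >-> n <= m}.
Proof.
apply/nondecreasing_seqP => k.
rewrite alpha_prodS [leRHS]mulrCA [leLHS]mulrC ler_wpM2l//.
  by rewrite ltW ?alpha_prod_gt0.
by rewrite mulrC metric_le_next.
Qed.

Lemma metric_le_first k u : Gnorm ip (M k) u <= Pinf * Gnorm ip (M 0) u.
Proof.
have := metric_div_nonincreasing u _ _ (leq0n k).
rewrite big_nil divr1 ler_pdivrMr ?alpha_prod_gt0// => /le_trans; apply.
by rewrite mulrC ler_wpM2r ?Gnorm_ge0 ?alpha_prod_le.
Qed.

Lemma metric_first_le k u : Gnorm ip (M 0) u <= Pinf * Gnorm ip (M k) u.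
Proof.
have := metric_mul_nondecreasing u _ _ (leq0n k).
rewrite big_nil mulr1 => /le_trans; apply.
by rewrite mulrC ler_wpM2r ?Gnorm_ge0 ?alpha_prod_le.
Qed.

(** Every metric is within the factor [Pinf] of [M 0], which is equivalent to [ip] in finite
    dimension; hence [K] does not depend on [k]. *)
Lemma metric_equiv : exists2 K : R, 0 < K & forall k u,
  Gnorm ip (M k) u <= K * ipnorm ip u /\ ipnorm ip u <= K * Gnorm ip (M k) u.
Proof.
have [K1 K10 K1P] := ipnorm_dominated hip _ (metric_ip 0).1.
have [K2 K20 K2P] := ipnorm_dominated (metric_ip 0) _ sip.
exists (Pinf * (K1 + K2)); first by rewrite mulr_gt0 ?Pinf_gt0// addr_gt0.
move=> k u; split.
  rewrite (le_trans (metric_le_first _ _))// -mulrA ler_wpM2l ?(ltW Pinf_gt0)//.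
  by rewrite (le_trans (K1P _))// ler_wpM2r ?ipnorm_ge0// lerDl ltW.
rewrite (le_trans (K2P _))// (@le_trans _ _ (K2 * (Pinf * Gnorm ip (M k) u)))//.
  by rewrite ler_wpM2l ?metric_first_le// ltW.
rewrite mulrA (mulrC K2) ler_wpM2r ?Gnorm_ge0// ler_wpM2l ?(ltW Pinf_gt0)//.
by rewrite lerDr ltW.
Qed.

Lemma metric_cvg u : cvgn (fun k => Gnorm ip (M k) u).
Proof.
have -> : (fun k => Gnorm ip (M k) u) =
    (fun k => Gnorm ip (M k) u / P k) \* (fun k => P k).
  by apply/funext => k /=; rewrite divfK// gt_eqF// alpha_prod_gt0.
apply: is_cvgM P_cvg; apply: nonincreasing_is_cvgn.
  exact: metric_div_nonincreasing.
exists 0 => _ [k _ <-] /=.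
by rewrite divr_ge0 ?Gnorm_ge0// ltW ?alpha_prod_gt0.
Qed.

Lemma metric_limit_exists : exists L, cvg_opnorm ip M L.
Proof.
apply: cvg_opnorm_exists => // u v.
have -> : (fun k => ip (M k u) v) = (fun k =>
    (Gnorm ip (M k) (u + v) * Gnorm ip (M k) (u + v)
     - Gnorm ip (M k) (u - v) * Gnorm ip (M k) (u - v)) * 4^-1).
  by apply/funext => k; rewrite (polarization (metric_ip k).1) !expr2.
apply: is_cvgMr_tmp; apply: is_cvgB; apply: is_cvgM; exact: metric_cvg.
Qed.

Section Limit.
Context {L : 'End(X)}.
Hypothesis ML : cvg_opnorm ip M L.

Lemma metric_cvg_limit u : Gnorm ip (M k) u @[k --> \oo] --> Gnorm ip L u.
Proof.
apply: continuous_cvg; first exact: sqrt_continuous.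
exact: cvg_opnorm_form.
Qed.

(** The nonincreasing sequence of norms divided by [P k] stays above its limit, the [L]-norm divided
    by [Pinf]. *)
Lemma metric_limit_le k u : Gnorm ip L u <= Pinf / P k * Gnorm ip (M k) u.
Proof.
have cv : (Gnorm ip (M k) u / P k) @[k --> \oo] --> Gnorm ip L u / Pinf.
  apply: cvgM; first exact: metric_cvg_limit.
  by apply: cvgV P_cvg; rewrite gt_eqF ?Pinf_gt0.
have := nonincreasing_cvgn_ge (metric_div_nonincreasing u) (cvgP _ cv) k.
rewrite (cvg_lim _ cv)// ler_pdivrMr ?Pinf_gt0// => /le_trans; apply.
by rewrite -[leLHS]mulrA [leLHS]mulrC (mulrC (P k)^-1).
Qed.

Lemma metric_le_limit k u : Gnorm ip (M k) u <= Pinf / P k * Gnorm ip L u.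
Proof.
have cv : (Gnorm ip (M k) u * P k) @[k --> \oo] --> Gnorm ip L u * Pinf.
  by apply: cvgM P_cvg; exact: metric_cvg_limit.
have := nondecreasing_cvgn_le (metric_mul_nondecreasing u) (cvgP _ cv) k.
rewrite (cvg_lim _ cv)// -ler_pdivlMr ?alpha_prod_gt0// => /le_trans; apply.
by rewrite -[leLHS]mulrA [leLHS]mulrC.
Qed.

Lemma metric_ratio_cvg : (Pinf / P k) @[k --> \oo] --> (1 : R).
Proof.
have PinfN0 : Pinf != 0 by rewrite gt_eqF ?Pinf_gt0.
have PV : (P k)^-1 @[k --> \oo] --> Pinf^-1 by exact: cvgV PinfN0 P_cvg.
by have := @cvgMl_tmp _ _ _ eventually_filter _ Pinf _ PV; rewrite divff.
Qed.

(** Strict positivity is not preserved by limits in general; here it comes from [metric_le_limit] at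
    index [0], which bounds the [L]-norm below by a multiple of the [M 0]-norm. *)
Lemma posdef_limit : posdef ip L.
Proof.
split=> [u v|u uN0].
  have Muv := cvg_opnorm_form hip _ _ u v ML.
  have := cvg_opnorm_form hip _ _ v u ML.
  rewrite (siC _ sip (L v)) => Mvu.
  apply: (cvg_unique _ Muv); first exact: Rhausdorff.
  apply: cvg_trans Mvu; apply: near_eq_cvg; apply: nearW => k /=.
  by rewrite (M_pd k).1 (siC _ sip).
have : 0 < Gnorm ip L u.
  have := metric_le_limit 0 u; rewrite big_nil divr1 => le0.
  rewrite -(pmulr_rgt0 _ Pinf_gt0) (lt_le_trans _ le0)//.
  by rewrite sqrtr_gt0 (M_pd 0).2.
by rewrite sqrtr_gt0.
Qed.

End Limit.

(** * Inexact proximal sequences *)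

Section ProximalSequence.
Context {F : X -> set X} {c eps : nat -> R} {x p : nat -> X} {cinf : \bar R}.
(* [monotone] alone would denote the notion of measure theory. *)
Hypothesis F_mono : Defs.monotone ip F.
Hypothesis F_resolvent : forall y, exists q, F q ((c 0)^-1 *: M 0 (y - q)).
Hypothesis c_gt0 : forall k, 0 < c k.
Hypothesis cinf_gt0 : (0 < cinf)%E.
Hypothesis c_cvg : (fun k => (c k)%:E) @ \oo --> cinf.
Hypothesis eps01 : forall k, 0 < eps k < 1.
Hypothesis eps_cvg : cvgn (series eps).
Hypothesis p_prox : forall k, F (p k) ((c k)^-1 *: M k (x k - p k)).
Hypothesis x_step : forall k, Gnorm ip (M k) (x k.+1 - p k) <=
  eps k * Num.min 1 (Gnorm ip (M k) (x k.+1 - x k)).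
Hypothesis zer_neq0 : zer F !=set0.

Local Notation N k u := (Gnorm ip (M k) u).
Local Notation w k := ((c k)^-1 *: M k (x k - p k)).

Lemma eps_ge0 k : 0 <= eps k.
Proof. by have /andP[/ltW] := eps01 k. Qed.

(** The two arguments of the minimum serve different ends: the absolute bound is summable and gives
    convergence, while the relative bound of [x_step_relative] gives the rate. *)
Lemma x_step_le k : N k (x k.+1 - p k) <= eps k.
Proof.
rewrite (le_trans (x_step k))// ler_piMr ?eps_ge0// ge_min lexx//.
Qed.

Lemma x_step_relative k : N k (x k.+1 - p k) <= eps k * N k (x k.+1 - x k).
Proof.
by rewrite (le_trans (x_step k))// ler_wpM2l ?eps_ge0// ge_min lexx orbT.
Qed.

Lemma prox_pythagoras k v : zer F v ->
  N k (p k - v) ^+ 2 + N k (x k - p k) ^+ 2 <= N k (x k - v) ^+ 2.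
Proof.
move=> Fv; pose g : X -> X -> R := fun u v => ip (M k u) v.
have si : semi_inner g by have [] := metric_ip k.
(* Monotonicity between the graph points [(p k, w k)] and [(v, 0)] makes the cross term
   nonnegative. *)
have ge0 : 0 <= g (x k - p k) (p k - v).
  have := F_mono (p k) v _ _ (p_prox k) Fv.
  by rewrite subr0 siZl// pmulr_rge0 ?invr_gt0.
rewrite -[Gnorm _ _]/(ipnorm g) !(sqr_ipnorm si).
have -> : x k - v = (x k - p k) + (p k - v) by rewrite subrKA.
move: (x k - p k) (p k - v) ge0 => a b ge0.
by rewrite !(siDl si, siDr si) (siC _ si b); lra.
Qed.

Lemma prox_nonexpansive k v : zer F v -> N k (p k - v) <= N k (x k - v).
Proof.
move=> Fv; rewrite -(ler_pXn2r (n := 2)) ?nnegrE ?Gnorm_ge0//.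
by rewrite (le_trans _ (prox_pythagoras k v Fv))// lerDl sqr_ge0.
Qed.

Lemma prox_gap_le k v : zer F v -> N k (x k - p k) <= N k (x k - v).
Proof.
move=> Fv; rewrite -(ler_pXn2r (n := 2)) ?nnegrE ?Gnorm_ge0//.
by rewrite (le_trans _ (prox_pythagoras k v Fv))// lerDr sqr_ge0.
Qed.

Lemma step_le_prox k v : N k (x k.+1 - v) <= N k (p k - v) + eps k.
Proof.
have [si _] := metric_ip k.
rewrite (le_trans (ler_ipnorm_dist si (p k) _ _))// addrC lerD2l.
exact: x_step_le.
Qed.

Lemma next_le_prox k v :
  N k.+1 (x k.+1 - v) <= alpha k.+1 * (N k (p k - v) + eps k).
Proof.
rewrite (le_trans (metric_next_le _ _))// ler_wpM2l ?(ltW (alpha_gt0 k))//.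
exact: step_le_prox.
Qed.

(* The errors being summable, [N k (x k - v) / P k - \sum_(j < k) eps j] is
   nonincreasing (quasi-Fejer monotonicity in the variable metric). *)
Lemma fejer_cvg v : zer F v -> cvgn (fun k => N k (x k - v)).
Proof.
move=> Fv; pose s k := N k (x k - v) / P k - series eps k.
have s_cvg : cvgn s.
  apply: nonincreasing_is_cvgn.
    apply/nonincreasing_seqP => k; rewrite /s seriesSr opprD addrA lerBlDr.
    rewrite addrAC lerD2r ler_pdivrMr ?alpha_prod_gt0//.
    rewrite (le_trans (next_le_prox k v))// alpha_prodS mulrA mulrC.
    rewrite ler_wpM2r ?(ltW (alpha_gt0 k))// mulrDl.
    rewrite divfK ?gt_eqF ?alpha_prod_gt0//.
    by rewrite lerD ?prox_nonexpansive// ler_peMr ?eps_ge0// alpha_prod_ge1.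
  exists (- limn (series eps)) => _ [k _ <-]; rewrite /s.
  have := nondecreasing_cvgn_le _ eps_cvg k.
  rewrite -lerN2 => /(_ _)/le_trans-> //; last first.
    by rewrite lerDr divr_ge0 ?Gnorm_ge0// ltW ?alpha_prod_gt0.
  by apply: nondecreasing_series => i _ _; exact: eps_ge0.
have -> : (fun k => N k (x k - v)) = (s + series eps) \* (fun k => P k).
  apply/funext => k /=; rewrite !fctE /s subrK divfK//.
  by rewrite gt_eqF ?alpha_prod_gt0.
by apply: is_cvgM P_cvg; exact: is_cvgD.
Qed.

Lemma eps_cvg0 : eps k @[k --> \oo] --> 0.
Proof. exact: cvg_series_cvg_0. Qed.

Lemma alpha_cvg1 : alpha k.+1 @[k --> \oo] --> (1 : R).
Proof.
have PinfN0 : Pinf != 0 by rewrite gt_eqF ?Pinf_gt0.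
have P1_cvg : P k.+1 @[k --> \oo] --> Pinf.
  by rewrite (cvg_shiftS (fun n => P n)).
have PV : (P k)^-1 @[k --> \oo] --> Pinf^-1 by exact: cvgV PinfN0 P_cvg.
have : (P k.+1 / P k) @[k --> \oo] --> Pinf / Pinf by exact: cvgM.
rewrite divff//; apply: cvg_trans.
apply: near_eq_cvg; apply: nearW => k /=.
by rewrite alpha_prodS mulrC mulKf// gt_eqF ?alpha_prod_gt0.
Qed.

(** The distances [d k] to a zero converge, and [next_le_prox] squeezes the distance from [p k]
    between [d k - e k] and [d k], where [e k] tends to [0]. The Pythagorean inequality, factored as
    a difference of squares, bounds the squared gap by [e k * (2 * d k)]. *)
Lemma prox_gap_cvg0 : N k (x k - p k) @[k --> \oo] --> 0.
Proof.
have [v Fv] := zer_neq0.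
pose d k := N k (x k - v); pose D := limn d.
have d_cvg : d k @[k --> \oo] --> D by exact: fejer_cvg.
pose e k := d k - (d k.+1 * (alpha k.+1)^-1 - eps k).
have e_cvg : e k @[k --> \oo] --> 0.
  have : e k @[k --> \oo] --> D - (D * 1^-1 - 0); last first.
    by rewrite invr1 mulr1 subr0 subrr.
  apply: cvgB => //; apply: cvgB eps_cvg0; apply: cvgM.
    by rewrite (cvg_shiftS d).
  by apply: cvgV; [exact: oner_neq0|exact: alpha_cvg1].
have gap_le k : N k (x k - p k) ^+ 2 <= e k * (2 * d k).
  have pd : N k (p k - v) <= d k by exact: prox_nonexpansive.
  have ed : d k - N k (p k - v) <= e k.
    rewrite /e lerD2l lerN2 lerBlDr ler_pdivrMr ?alpha_gt0// mulrC.
    exact: next_le_prox.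
  have := prox_pythagoras k v Fv; rewrite -/(d k).
  have dp0 : 0 <= N k (p k - v) by exact: Gnorm_ge0.
  have : (d k - N k (p k - v)) * (d k + N k (p k - v)) <= e k * (2 * d k).
    by rewrite ler_pM// ?subr_ge0 ?addr_ge0// ?(le_trans dp0)//; lra.
  by lra.
apply: (squeeze_cvg0 (g := fun k => Num.sqrt (e k * (2 * d k)))).
  move=> k; rewrite Gnorm_ge0/= -[leLHS]ger0_norm ?Gnorm_ge0//.
  by rewrite -sqrtr_sqr ler_wsqrtr.
have : Num.sqrt (e k * (2 * d k)) @[k --> \oo] -->
    Num.sqrt (0 * (2 * D)); last first.
  by rewrite mul0r sqrtr0.
apply: continuous_cvg; first exact: sqrt_continuous.
by apply: cvgM => //; exact: cvgMl_tmp.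
Qed.

Lemma prox_gap_ipnorm_cvg0 : ipnorm ip (x k - p k) @[k --> \oo] --> 0.
Proof.
have [K K0 KP] := metric_equiv.
apply: (squeeze_cvg0 (g := fun k => K * N k (x k - p k))).
  by move=> k; rewrite ipnorm_ge0 (KP k _).2.
by rewrite -(mulr0 K); apply: cvgMl_tmp; exact: prox_gap_cvg0.
Qed.

Lemma c_near_ge c' : (c'%:E < cinf)%E -> \forall k \near \oo, c' <= c k.
Proof.
case: cinf cinf_gt0 c_cvg => [ci| |]// _.
  by move=> /fine_cvg/cvgr_ge + c'c; apply; rewrite -lte_fin.
move=> /cvgey_gt/(_ c') c'c _.
by apply: filterS c'c => k; rewrite lte_fin => /ltW.
Qed.

(** Pairing [w k] with itself and applying Cauchy-Schwarz in the metric [M k] leaves one factor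
    [ipnorm ip (w k)] to cancel. The factor [(c k)^-1] is eventually at most [c'^-1] for some
    positive [c'] below [cinf]. *)
Lemma residual_cvg0 : ipnorm ip (w k) @[k --> \oo] --> 0.
Proof.
have [K K0 KP] := metric_equiv.
have [c' c'0 /c_near_ge c'c] : exists2 c', 0 < c' & (c'%:E < cinf)%E.
  case: cinf cinf_gt0 => [ci| |]//; rewrite ?lte_fin.
    by exists (ci / 2); rewrite ?lte_fin; lra.
  by exists 1; rewrite ?ltry.
apply: (squeeze_cvgr (f := fun=> 0) (h := fun k => c'^-1 * K * N k (x k - p k))).
- near=> k; rewrite ipnorm_ge0/=.
  have [->|wN0] := eqVneq (ipnorm ip (w k)) 0.
    by rewrite !mulr_ge0 ?invr_ge0 ?Gnorm_ge0// ltW.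
  have w0 : 0 < ipnorm ip (w k) by rewrite lt_def wN0 ipnorm_ge0.
  rewrite -(ler_pM2r w0) -expr2 (sqr_ipnorm sip) {1}(siZl sip).
  have cN : 0 <= (c k)^-1 by rewrite invr_ge0 ltW.
  have CS : ip (M k (x k - p k)) (w k) <= N k (x k - p k) * (K * ipnorm ip (w k)).
    apply: le_trans (cauchy_schwarz_le (metric_ip k).1 _ _) _.
    by rewrite ler_wpM2l ?Gnorm_ge0// (KP k _).1.
  apply: le_trans (ler_wpM2l cN CS) _.
  have -> : c'^-1 * K * N k (x k - p k) * ipnorm ip (w k) =
      c'^-1 * (N k (x k - p k) * (K * ipnorm ip (w k))) by ring.
  rewrite ler_wpM2r ?mulr_ge0 ?Gnorm_ge0 ?ipnorm_ge0 ?(ltW K0)//.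
  by rewrite lef_pV2 ?posrE//; near: k.
- exact: cvg_cst.
- rewrite -(mulr0 (c'^-1 * K)); apply: cvgMl_tmp; exact: prox_gap_cvg0.
Unshelve. all: by end_near. Qed.

(** The resolvent stands in for maximality. With [q] the proximal point of [l] and [m] the
    associated value, monotonicity against [(p k, w k)] gives [ip m (l - q) <= 0] in the limit. This
    pairing is a positive multiple of the squared [M 0]-norm of [l - q], so [l = q] and [m = 0]. *)
Lemma frequent_limit_zer l :
  (forall e, 0 < e -> forall n, exists2 k, (n <= k)%N & ipnorm ip (p k - l) < e) ->
  zer F l.
Proof.
move=> pl; have [q Fq] := F_resolvent l.
set m := _ *: _ in Fq.
have mE : ip m (l - q) = (c 0)^-1 * ip (M 0 (l - q)) (l - q) by rewrite siZl.
have small : ip m (l - q) <= 0.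
  (* Since [e <= 1], the total error [e * (e + ipnorm ip (l - q) + ipnorm ip m)] is at most [e * C],
     hence at most [d]. *)
  pose C := 1 + ipnorm ip (l - q) + ipnorm ip m.
  have C0 : 0 < C by rewrite /C -addrA ltr_pwDl// addr_ge0 ?ipnorm_ge0.
  apply/ler_addgt0Pr => d d0; rewrite add0r.
  pose e := Num.min 1 (d / C).
  have e0 : 0 < e by rewrite lt_min ltr01 divr_gt0.
  have e1 : e <= 1 by rewrite ge_min lexx.
  have eC : e * C <= d by rewrite -ler_pdivlMr// ge_min lexx orbT.
  have [n _ wn] : \forall k \near \oo, ipnorm ip (w k) < e.
    exact: cvgr_lt residual_cvg0 _ e0.
  have [k nk pk] := pl e e0 n.
  have := F_mono (p k) q _ _ (p_prox k) Fq.
  rewrite (siBl sip) -[X in _ - ip m X](subrKA l) (siDr sip _ _ m).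
  have pq : ipnorm ip (p k - q) <= e + ipnorm ip (l - q).
    by rewrite (le_trans (ler_ipnorm_dist sip l _ _))// lerD2r ltW.
  have wpq : ip (w k) (p k - q) <= e * (e + ipnorm ip (l - q)).
    rewrite (le_trans (cauchy_schwarz_le sip _ _))// ler_pM ?ipnorm_ge0//.
    by rewrite ltW//; exact: wn.
  have mpl : - ip m (p k - l) <= ipnorm ip m * e.
    rewrite -(siNr sip) (le_trans (cauchy_schwarz_le sip _ _))//.
    by rewrite (ipnormN sip) ler_wpM2l ?ipnorm_ge0// ltW.
  have : e * (e + ipnorm ip (l - q)) + ipnorm ip m * e <= e * C.
    by rewrite (mulrC _ e) -mulrDr ler_wpM2l ?(ltW e0)// /C !lerD2r.
  by lra.
have lq : l - q = 0.
  apply: (metric_ip 0).2; apply/eqP; rewrite eq_le (si_ge0 _ (metric_ip 0).1).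
  by move: small; rewrite mE pmulr_rle0 ?invr_gt0// => ->.
have -> : l = q by apply/eqP; rewrite -subr_eq0 lq.
by move: Fq; rewrite /m lq linear0 scaler0.
Qed.

(** Opial's argument: a cluster point [l] exists by boundedness and is a zero, so the distances to
    [l] converge; being small infinitely often, they have limit [0]. *)
Lemma sequence_cvg : exists2 l, zer F l & cvg_ipnorm ip x l.
Proof.
have [K K0 KP] := metric_equiv; have [v Fv] := zer_neq0.
have [B [_ /(_ (B + 1))]] := cvg_seq_bounded (fejer_cvg v Fv).
rewrite ltrDl ltr01 => /(_ isT) bounded.
have [k|l0 l0P] := bounded_frequently_near hip (fun k => x k - v) (K * (B + 1)).
  rewrite (le_trans (KP k _).2)// ler_wpM2l ?(ltW K0)//.
  by rewrite (le_trans (ler_norm _))//; exact: bounded.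
pose l := l0 + v.
have xl e : 0 < e -> forall n, exists2 k, (n <= k)%N & ipnorm ip (x k - l) < e.
  move=> e0 n; have [k nk xk] := l0P e e0 n; exists k => //.
  by rewrite opprD addrA addrAC.
have Fl : zer F l.
  apply: frequent_limit_zer => e e0 n.
  have e20 : 0 < e / 2 by rewrite divr_gt0.
  have [n' _ gap] : \forall k \near \oo, ipnorm ip (x k - p k) < e / 2.
    exact: cvgr_lt prox_gap_ipnorm_cvg0 _ e20.
  have [k nk xk] := xl _ e20 (maxn n n').
  exists k; first by rewrite (leq_trans (leq_maxl n n')).
  rewrite (le_lt_trans (ler_ipnorm_dist sip (x k) _ _))//.
  rewrite (splitr e) ltrD// ipnorm_distC//.
  by apply: gap; rewrite /= (leq_trans (leq_maxr n n')).
exists l => //.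
have d_cvg := fejer_cvg l Fl.
have lim0 : limn (fun k => N k (x k - l)) = 0.
  apply/eqP/negPn/negP => limN0.
  have lim_gt0 : 0 < limn (fun k => N k (x k - l)).
    rewrite lt_def limN0; apply: (cvgr_to_ge d_cvg).
    by apply: nearW => k; exact: Gnorm_ge0.
  have [n _ far] : \forall k \near \oo,
      limn (fun k => N k (x k - l)) / 2 < N k (x k - l).
    by apply: (cvgr_gt _ d_cvg); rewrite ltr_pdivrMr// ltr_pMr// ltr1n.
  have [k nk] := xl (limn (fun k => N k (x k - l)) / 2 / K)
    (divr_gt0 (divr_gt0 lim_gt0 (ltr0n _ 2)) K0) n.
  rewrite ltr_pdivlMr// mulrC => xk.
  have := lt_le_trans (far k nk) (KP k _).1.
  by move/lt_trans => /(_ _ xk); rewrite ltxx.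
apply: (squeeze_cvg0 (g := fun k => K * N k (x k - l))).
  by move=> k; rewrite ipnorm_ge0 (KP k _).2.
have : K * N k (x k - l) @[k --> \oo] --> K * limn (fun k => N k (x k - l)).
  exact: cvgMl_tmp.
by rewrite lim0 mulr0.
Qed.

Lemma prox_cvg l : cvg_ipnorm ip x l -> ipnorm ip (p k - l) @[k --> \oo] --> 0.
Proof.
move=> xl.
apply: (squeeze_cvg0 (g := fun k => ipnorm ip (x k - p k) + ipnorm ip (x k - l))).
  move=> k; rewrite ipnorm_ge0/= (ipnorm_distC sip (x k)).
  exact: ler_ipnorm_dist.
by rewrite -(addr0 0); apply: cvgD => //; exact: prox_gap_ipnorm_cvg0.
Qed.

(** A real-valued form of [Gdist], faithful because [zer F] is nonempty, so that the estimates take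
    place in [R]. *)
Definition zer_dist (G : 'End(X)) y : R :=
  inf [set Gnorm ip G (y - v) | v in zer F].

Let zer_dist_has_lbound G y : has_lbound [set Gnorm ip G (y - v) | v in zer F].
Proof. by exists 0 => _ [v _ <-]; exact: Gnorm_ge0. Qed.

Let zer_dist_neq0 G y : [set Gnorm ip G (y - v) | v in zer F] !=set0.
Proof. by have [v Fv] := zer_neq0; exists (Gnorm ip G (y - v)), v. Qed.

Lemma Gdist_zer G y : Gdist ip G y (zer F) = (zer_dist G y)%:E.
Proof.
rewrite -ereal_inf_EFin//; congr (ereal_inf _).
by rewrite image_comp.
Qed.

Lemma zer_dist_le G y v : zer F v -> zer_dist G y <= Gnorm ip G (y - v).
Proof. by move=> Fv; apply: ge_inf => //; exists v. Qed.

Lemma le_zer_dist G y m : (forall v, zer F v -> m <= Gnorm ip G (y - v)) ->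
  m <= zer_dist G y.
Proof. by move=> mP; apply: lb_le_inf => // _ [v Fv <-]; exact: mP. Qed.

Lemma zer_dist_ge0 G y : 0 <= zer_dist G y.
Proof. by apply: le_zer_dist => v _; exact: Gnorm_ge0. Qed.

Lemma zer_dist_scale (G H : 'End(X)) l y : 0 < l ->
  (forall u, Gnorm ip G u <= l * Gnorm ip H u) ->
  zer_dist G y <= l * zer_dist H y.
Proof.
move=> l0 GH; rewrite -ler_pdivrMl//; apply: le_zer_dist => v Fv.
by rewrite ler_pdivrMl// (le_trans (zer_dist_le _ _ _ Fv)).
Qed.

Lemma zer_dist_triangle k y y' :
  zer_dist (M k) y <= N k (y - y') + zer_dist (M k) y'.
Proof.
rewrite -lerBlDl; apply: le_zer_dist => v Fv; rewrite lerBlDl.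
rewrite (le_trans (zer_dist_le _ _ _ Fv))//.
exact: (ler_ipnorm_dist (metric_ip k).1).
Qed.

(** The inequality for each zero [v] passes to the infimum on the right once the first term is
    lowered to the distance; no nearest zero has to be chosen. *)
Lemma zer_dist_pythagoras k :
  zer_dist (M k) (p k) ^+ 2 + N k (x k - p k) ^+ 2 <= zer_dist (M k) (x k) ^+ 2.
Proof.
set s := _ + _; have s0 : 0 <= s by rewrite addr_ge0 ?sqr_ge0.
rewrite -(sqr_sqrtr s0) ler_pXn2r ?nnegrE ?sqrtr_ge0 ?zer_dist_ge0//.
apply: le_zer_dist => v Fv.
rewrite -[leRHS]ger0_norm ?Gnorm_ge0// -sqrtr_sqr ler_wsqrtr//.
apply: le_trans (prox_pythagoras k v Fv); rewrite lerD2r.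
by rewrite ler_pXn2r ?nnegrE ?Gnorm_ge0 ?zer_dist_ge0 ?zer_dist_le.
Qed.

(** * One-step contraction and the Q-linear rate *)

Section Rate.
Context {L : 'End(X)}.
Hypothesis ML : cvg_opnorm ip M L.

Local Notation lam k := (Pinf / P k).

(* The one-step contraction factor of the distance to [zer F]; [a] is a
   subregularity constant and [c' <= c k]. *)
Definition step_factor a c' k : R := lam k ^+ 2 *
  (contraction (a * lam k ^+ 2 / c') + eps k / (1 - eps k)).

Lemma lam_gt0 k : 0 < lam k.
Proof. by rewrite divr_gt0 ?alpha_prod_gt0 ?Pinf_gt0. Qed.

(** Subregularity lives in the metric [L], the Pythagorean inequality in [M k]. Converting the
    distance and the dual norm costs [lam k] each, hence [lam k ^+ 2] inside [contraction];
    converting the final estimate back at both ends costs the outer [lam k ^+ 2]. *)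
Lemma one_step_contraction a c' k : 0 < a -> 0 < c' -> c' <= c k ->
  zer_dist L (p k) <= a * Gnorm ip (L^-1)%VF (w k) ->
  zer_dist L (x k.+1) <= step_factor a c' k * zer_dist L (x k).
Proof.
move=> a0 c'0 c'c subreg_p.
have l0 := lam_gt0 k; have si := (metric_ip k).1.
pose E := zer_dist (M k) (x k); pose n := N k (x k - p k).
have n0 : 0 <= n by exact: Gnorm_ge0.
have E0 : 0 <= E by exact: zer_dist_ge0.
have wn : Gnorm ip (L^-1)%VF (w k) <= lam k * (c'^-1 * n).
  rewrite -linearZ/=.
  have dual := dual_norm_image hip L (M k) (lam k) ((c k)^-1 *: (x k - p k))
    (posdef_limit ML) (M_pd k) (ltW l0) (metric_le_limit ML k).
  rewrite (le_trans dual)// ler_wpM2l ?(ltW l0)// [leLHS](ipnormZ si).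
  by rewrite ger0_norm ?invr_ge0 ?(ltW (c_gt0 k))// ler_wpM2r// lef_pV2 ?posrE.
pose b := a * lam k ^+ 2 / c'.
have b0 : 0 <= b by exact: divr_ge0 (mulr_ge0 (ltW a0) (sqr_ge0 _)) (ltW c'0).
have Dbn : zer_dist (M k) (p k) <= b * n.
  apply: le_trans (zer_dist_scale (M k) L (lam k) _ l0 (metric_le_limit ML k)) _.
  have -> : b * n = lam k * (a * (lam k * (c'^-1 * n))) by rewrite /b; ring.
  rewrite ler_wpM2l ?(ltW l0)// (le_trans subreg_p)//.
  by rewrite ler_wpM2l ?(ltW a0).
have DE : zer_dist (M k) (p k) <= contraction b * E.
  exact: le_contraction (zer_dist_ge0 _ _) E0 n0 b0 Dbn (zer_dist_pythagoras k).
have /andP[e0 e1] := eps01 k.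
have nE : n <= E by apply: le_zer_dist => v Fv; exact: prox_gap_le.
(* The relative error bound is absorbed on the left of the triangle inequality, leaving [1 - eps k]
   times the step below [n <= E]. *)
have stepE : N k (x k.+1 - x k) <= E / (1 - eps k).
  rewrite ler_pdivlMr ?subr_gt0//.
  have tri : N k (x k.+1 - x k) <= N k (x k.+1 - p k) + n.
    have := ler_ipnorm_dist si (p k) (x k.+1) (x k).
    by rewrite (ipnorm_distC si (p k)).
  by have := x_step_relative k; lra.
have step_p : N k (x k.+1 - p k) <= eps k / (1 - eps k) * E.
  rewrite (le_trans (x_step_relative k))// -mulrA ler_wpM2l ?(ltW e0)//.
  by rewrite mulrC.
have DE' : zer_dist (M k) (x k.+1) <= (contraction b + eps k / (1 - eps k)) * E.
  rewrite (le_trans (zer_dist_triangle k _ (p k)))// mulrDl addrC.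
  by rewrite lerD.
have EL : E <= lam k * zer_dist L (x k).
  exact: (zer_dist_scale (M k) L (lam k) _ l0 (metric_le_limit ML k)).
apply: le_trans (zer_dist_scale L (M k) (lam k) _ l0 (metric_limit_le ML k)) _.
rewrite /step_factor -/b; set s := contraction b + _ in DE' *.
have -> : lam k ^+ 2 * s * zer_dist L (x k) =
    lam k * (s * (lam k * zer_dist L (x k))) by ring.
rewrite ler_wpM2l ?(ltW l0)// (le_trans DE')// ler_wpM2l//.
apply: addr_ge0; first exact: divr_ge0 b0 (sqrtr_ge0 _).
by rewrite divr_ge0 ?(ltW e0)// subr_ge0 ltW.
Qed.

Lemma step_factor_cvg a c' :
  step_factor a c' k @[k --> \oo] --> contraction (a / c').
Proof.
have lam1 : lam k @[k --> \oo] --> (1 : R) by exact: metric_ratio_cvg.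
have lam2 : lam k ^+ 2 @[k --> \oo] --> (1 : R).
  under eq_fun do rewrite expr2.
  have : (lam k * lam k) @[k --> \oo] --> (1 * 1 : R) by exact: cvgM.
  by rewrite mulr1.
have e0 : (eps k / (1 - eps k)) @[k --> \oo] --> (0 : R).
  have : (eps k / (1 - eps k)) @[k --> \oo] --> (0 / (1 - 0) : R).
    apply: cvgM eps_cvg0 _; apply: cvgV; first by rewrite subr0 oner_neq0.
    by apply: cvgB eps_cvg0; exact: cvg_cst.
  by rewrite mul0r.
have : step_factor a c' k @[k --> \oo] --> 1 * (contraction (a * 1 / c') + 0).
  apply: cvgM => //; apply: cvgD => //; apply: contraction_cvg.
  by apply: cvgMr_tmp; exact: cvgMl_tmp.
by rewrite mul1r mulr1 addr0.
Qed.

(** The exact pairs [(p k, w k)] lie in the graph of [F] and tend to [(zbar, 0)], so they eventually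
    enter the neighborhood of subregularity. *)
Lemma subreg_constant_near a zbar : cvg_ipnorm ip x zbar ->
  subreg_constant ip L F zbar 0 a ->
  \forall k \near \oo, zer_dist L (p k) <= a * Gnorm ip (L^-1)%VF (w k).
Proof.
move=> xz [_ [U [e e0 eU] Ua]].
near=> k.
have := Ua (p k) (w k) _ (p_prox k); rewrite subr0 -/(zer F) Gdist_zer lee_fin.
apply; apply: eU => /=.
  near: k; exact: (cvgr_lt _ (prox_cvg _ xz) _ e0).
rewrite subr0; near: k; exact: (cvgr_lt _ residual_cvg0 _ e0).
Unshelve. all: by end_near. Qed.

Lemma proximal_rate zbar : cvg_ipnorm ip x zbar ->
  metrically_subregular ip L F zbar 0 ->
  let ainf := subreg ip L F zbar 0 in
  (ainf < +oo)%E /\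
  Qlinear (fun k => Gdist ip L (x k) (zer F)) (rate (fine ainf) cinf).
Proof.
move=> xz [_ [a1 a1P]] ainf.
have ainf_ge0 : (0 <= ainf)%E.
  by apply: le_ereal_inf_tmp => _ [a [a0 _] <-]; rewrite lee_fin ltW.
have ainf_lty : (ainf < +oo)%E.
  apply: le_lt_trans (ltry a1); apply: ereal_inf_lbound.
  by exists a1.
have ainf_fin : ainf \is a fin_num by rewrite ge0_fin_numE.
have fine0 : 0 <= fine ainf by rewrite fine_ge0.
split=> //; split.
- by move=> k; rewrite Gdist_zer lee_fin zer_dist_ge0 ltry.
- exact: rate_bounds.
move=> rho rrho.
have [c' [c'0 c'c]] := rate_threshold _ _ _ fine0 cinf_gt0 rrho.
(* The infimum need not be a valid constant itself, but some valid [a] lies below the strict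
   threshold. *)
rewrite -lte_fin fineK// => /ereal_inf_lt[_ [a aP <-]]; rewrite lte_fin => atau.
have a0 : 0 < a by case: aP.
have /andP[rrho1 rho1] := rrho.
have rho0 : 0 < rho.
  by apply: le_lt_trans rrho1; case/andP: (rate_bounds _ _ fine0 cinf_gt0).
have factor_lt : contraction (a / c') < rho.
  apply: contraction_lt; first by rewrite divr_ge0// ltW.
    by rewrite rho0.
  by rewrite ltr_pdivrMr.
near=> k; rewrite !Gdist_zer -EFinM lee_fin.
apply: le_trans (one_step_contraction a c' k a0 c'0 _ _) _.
- by near: k; exact: c_near_ge.
- by near: k; exact: subreg_constant_near xz aP.
- rewrite ler_wpM2r ?zer_dist_ge0//; near: k.
  exact: cvgr_le (step_factor_cvg a c') _ factor_lt.
Unshelve. all: by end_near. Qed.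

End Rate.
End ProximalSequence.
End VariableMetric.

(** * Reduction to the active component *)

Lemma dot_inner_product (R : realType) (V : vectType R) (ip : {dot V for idfun}) :
  inner_product ip.
Proof.
split; first split.
- by move=> u v; rewrite hermC expr0 mul1r.
- by move=> a u v w; rewrite linearPl.
- move=> u; have [->|/neq0_dnorm_gt0/ltW//] := eqVneq u 0.
  by rewrite linear0l.
- move=> u uu0; apply/eqP/negPn/negP => /neq0_dnorm_gt0.
  by move=> /(_ _ ip); rewrite uu0 ltxx.
Qed.

Section ProjectedProblem.
Context {R : realType} {V : vectType R} {ip : V -> V -> R} {Hs Hss : {vspace V}}.
Hypothesis hip : inner_product ip.
Hypothesis hsplit : orthogonal_splitting ip Hs Hss.
Let sip : semi_inner ip := hip.1.
Local Notation ips := (ip_star ip Hs).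
Local Notation star z := (star Hs Hss z).

Lemma ip_star_inner : inner_product ips.
Proof.
split; first split.
- by move=> u v; exact: siC _ sip _ _.
- by move=> a u v w; rewrite /ip_star linearP/= (siZD _ sip).
- by move=> u; exact: si_ge0 _ sip _.
- by move=> u /hip.2 u0; apply: val_inj; rewrite [LHS]u0 (linear0 vsval).
Qed.

Lemma splitting_direct : (Hs :&: Hss = 0)%VS.
Proof.
apply/eqP; rewrite -subv0; apply/subvP => u; rewrite memv_cap => /andP[us uss].
by rewrite memv0; apply/eqP/hip.2/hsplit.2.
Qed.

Lemma val_star z : vsval (star z) = daddv_pi Hs Hss z.
Proof. by rewrite vsprojK// memv_pi. Qed.

Lemma star_decomposition z :
  vsval (star z) + vsval (vsproj Hss (daddv_pi Hss Hs z)) = z.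
Proof.
rewrite val_star vsprojK ?memv_pi// daddv_pi_add ?splitting_direct//.
by rewrite hsplit.1 memvf.
Qed.

Section AlignedOperator.
Context {B : 'End(V)}.
Hypothesis Bal : aligned ip Hs Hss B.

Lemma val_op_star (u : subvs_of Hs) : vsval (op_star Hs B u) = B (vsval u).
Proof.
case: Bal => _ BHs _; rewrite /op_star lfunE/= vsprojK//.
by have := memv_img B (memvf (vsval u)); rewrite BHs.
Qed.

Lemma aligned_star z : B (vsval (star z)) = B z.
Proof.
case: Bal => _ _ BHss; rewrite -{2}(star_decomposition z) linearD/=.
rewrite [X in _ + X](_ : _ = 0) ?addr0//; apply/eqP; rewrite -memv_ker.
by rewrite BHss subvsP.
Qed.

Lemma op_star_posdef : posdef ips (op_star Hs B).
Proof.
have [Bpsd _ BHss] := Bal; have sB := possemidef_semi_inner hip _ Bpsd.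
split=> [u v|u uN0]; first by rewrite /ip_star !val_op_star Bpsd.1.
rewrite lt_def /ip_star val_op_star (si_ge0 _ sB) andbT; apply: contra uN0.
(* Cauchy-Schwarz for the form of [B], applied to [u] and [B u], turns a vanishing quadratic form
   into [B u = 0]. Then [u] lies in both summands and is orthogonal to itself. *)
move=> /eqP Buu0; have Bu0 : B (vsval u) = 0.
  apply: hip.2; apply/eqP; rewrite -sqrf_eq0 eq_le sqr_ge0 andbT.
  by have := semi_inner_sqr_le sB (vsval u) (B (vsval u)); rewrite /= Buu0 mul0r.
have uHss : vsval u \in Hss by rewrite -BHss memv_ker Bu0.
apply/eqP/val_inj; rewrite [RHS](linear0 vsval).
by apply: hip.2; apply: hsplit.2 => //; exact: subvsP.
Qed.

End AlignedOperator.

Context {T : V -> set V}.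
Hypothesis T_mono : Defs.monotone ip T.
Local Notation Ts := (map_star Hs Hss T).

(** The values lie in [Hs], so the [Hss] components of the arguments drop out of the pairing. *)
Lemma map_star_monotone : Defs.monotone ips Ts.
Proof.
move=> x y u v [xx Tx] [yy Ty]; have := T_mono _ _ _ _ Tx Ty.
rewrite opprD addrACA (siDr sip).
have -> : ip (vsval u - vsval v) (vsval xx - vsval yy) = 0.
  by apply: hsplit.2; apply: memvB; exact: subvsP.
by rewrite addr0 /ip_star !linearB.
Qed.

Lemma map_starI z w : T z (vsval w) -> Ts (star z) w.
Proof.
by move=> Tz; exists (vsproj Hss (daddv_pi Hss Hs z)); rewrite star_decomposition.
Qed.

Lemma zer_map_star : zer T !=set0 -> zer Ts !=set0.
Proof.
by move=> [z Tz]; exists (star z); apply: map_starI; rewrite linear0.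
Qed.

Lemma map_star_resolvent c B : implementable ip Hs Hss T -> 0 < c ->
  aligned ip Hs Hss B ->
  forall y, exists q, Ts q (c^-1 *: op_star Hs B (y - q)).
Proof.
move=> Timp c0 Bal y; have [z [t [Tz /eqP]]] := Timp c B (vsval y) c0 Bal.
rewrite addr_eq0 => /eqP tE; exists (star z); apply: map_starI.
move: Tz; rewrite tE -scalerN -linearN opprB.
by rewrite linearZ/= val_op_star// (linearB vsval)/= !(linearB B)/= aligned_star.
Qed.

(** A residual [r] yields a value of [Ts] at [star z]; monotonicity against the exact proximal point
    [p] gives [c^-1 * ny ^+ 2 <= ips r y]. Dual Cauchy-Schwarz bounds the right side by the dual
    norm of [r] times [ny], and one [ny] cancels. *)
Lemma residual_prox_bound c B x z d (p : subvs_of Hs) : 0 < c ->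
  aligned ip Hs Hss B ->
  (c%:E * Gdist ips ((op_star Hs B)^-1)%VF 0 (residual_star Hs T c B x z)
    <= d%:E)%E ->
  Ts p (c^-1 *: op_star Hs B (star x - p)) ->
  Gnorm ips (op_star Hs B) (star z - p) <= d.
Proof.
move=> c0 Bal Dd Tp; have Bpd := op_star_posdef Bal.
have sB := (posdef_inner_product ip_star_inner _ Bpd).1.
set y := star z - p; set ny := Gnorm _ _ _.
have ny0 : 0 <= ny by exact: sqrtr_ge0.
rewrite -lee_fin (le_trans _ Dd)// -lee_pdivrMl// -EFinM.
(* A lower bound over all residuals suffices; it also covers an empty residual set, at distance
   [+oo]. *)
apply: le_ereal_inf_tmp => _ [r [t Tz rE] <-]; rewrite lee_fin sub0r.
have -> : Gnorm ips ((op_star Hs B)^-1)%VF (- r) =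
    Gnorm ips ((op_star Hs B)^-1)%VF r.
  rewrite !(Gnorm_inv ip_star_inner)// linearN.
  exact: ipnormN sB _.
have Tzr : Ts (star z) (r - c^-1 *: op_star Hs B (star z - star x)).
  apply: map_starI; rewrite linearB/= rE linearZ/= val_op_star//.
  suff -> : B (z - x) = B (vsval (star z - star x)).
    by rewrite scalerN addrK.
  by rewrite (linearB vsval)/= !(linearB B)/= !aligned_star.
have := map_star_monotone _ _ _ _ Tzr Tp.
rewrite -/y -addrA -opprD -scalerDr -linearD/= [_ + (star x - p)]subrKA -/y.
rewrite (siBl ip_star_inner.1) (siZl ip_star_inner.1) subr_ge0.
rewrite -[ips (op_star Hs B y) y](sqr_ipnorm sB) -/ny.
have := dual_pairing ip_star_inner _ r y Bpd; rewrite -/ny => pair le_r.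
have [->|nyN0] := eqVneq ny 0; first by rewrite mulr0 sqrtr_ge0.
have ny_gt0 : 0 < ny by rewrite lt_def nyN0.
by rewrite -(ler_pM2r ny_gt0) -mulrA -expr2 (le_trans le_r).
Qed.

End ProjectedProblem.

Theorem corollary4p5 (R : realType) (V : vectType R) (ip : {dot V for idfun})
  (Hs Hss : {vspace V}) (T : V -> set V)
  (c : nat -> R) (cinf : \bar R) (B : nat -> 'End(V))
  (alpha eps : nat -> R) (z : nat -> V) :
  let ips := ip_star ip Hs in
  let Ts := map_star Hs Hss T in
  let Bs k := op_star Hs (B k) in
  let zs k := star Hs Hss (z k) in
  orthogonal_splitting ip Hs Hss ->
  maximal_monotone ip T ->
  zer T !=set0 ->
  implementable ip Hs Hss T ->
  (forall k, 0 < c k) ->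
  (forall k, aligned ip Hs Hss (B k)) ->
  (forall k, (1 <= k)%N -> 1 <= alpha k) ->
  (forall k, (1 <= k)%N -> forall u : subvs_of Hs,
     (alpha k)^-1 * Gnorm ips (Bs k.-1) u <= Gnorm ips (Bs k) u
       <= alpha k * Gnorm ips (Bs k.-1) u) ->
  cvgn (fun n => \prod_(1 <= k < n.+1) alpha k) ->
  (0 < cinf)%E ->
  (fun k => (c k)%:E) @ \oo --> cinf ->
  (forall k, 0 < eps k < 1) ->
  cvgn (series eps) ->
  (forall k,
     ((c k)%:E *
        Gdist ips ((Bs k)^-1)%VF 0 (residual_star Hs T (c k) (B k) (z k) (z k.+1))
      <= (eps k * Num.min 1 (Gnorm ips (Bs k) (zs k.+1 - zs k)))%:E)%E) ->
  [/\ exists2 Binf, posdef ips Binf & cvg_opnorm ips Bs Binf,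
      exists2 zbar, zer Ts zbar & cvg_ipnorm ips zs zbar
    & forall (Binf : 'End(subvs_of Hs)) (zbar : subvs_of Hs),
        cvg_opnorm ips Bs Binf -> cvg_ipnorm ips zs zbar ->
        metrically_subregular ips Binf Ts zbar 0 ->
        let ainf := subreg ips Binf Ts zbar 0 in
        (ainf < +oo)%E /\
        Qlinear (fun k => Gdist ips Binf (zs k) (zer Ts))
          (rate (fine ainf) cinf)].
Proof.
move=> ips Ts Bs zs hsplit [T_mono _] zerT Timp c_gt0 Bal alpha_ge1 ratio P_cvg.
move=> cinf_gt0 c_cvg eps01 eps_cvg step.
have hip := dot_inner_product _ _ ip.
have hips : inner_product ips := ip_star_inner hip.
have Bs_pd k : posdef ips (Bs k) by exact (op_star_posdef hip hsplit (Bal k)).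
have Ts_mono : Defs.monotone ips Ts
  by exact (map_star_monotone hip hsplit T_mono).
have Ts_zer : zer Ts !=set0 by exact (zer_map_star hip hsplit zerT).
have Ts_res k y : exists q, Ts q ((c k)^-1 *: Bs k (y - q)).
  exact (map_star_resolvent hip hsplit _ _ Timp (c_gt0 k) (Bal k) y).
(* Exact proximal points of the active iterates; the stopping criterion then says that [zs k.+1] is
   close to [p k]. *)
have [p p_prox] := choice (fun k => Ts_res k (zs k)).
have p_step k : Gnorm ips (Bs k) (zs k.+1 - p k) <=
    eps k * Num.min 1 (Gnorm ips (Bs k) (zs k.+1 - zs k)).
  exact (residual_prox_bound hip hsplit T_mono _ _ _ _ _ _ (c_gt0 k) (Bal k)
    (step k) (p_prox k)).
split.
- have [L BL] := metric_limit_exists hips Bs_pd alpha_ge1 ratio P_cvg.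
  by exists L => //; exact (posdef_limit hips Bs_pd alpha_ge1 ratio P_cvg BL).
- exact (sequence_cvg hips Bs_pd alpha_ge1 ratio P_cvg Ts_mono (Ts_res 0%N) c_gt0
    cinf_gt0 c_cvg eps01 eps_cvg p_prox p_step Ts_zer).
- move=> Binf zbar BL zz sub.
  exact (proximal_rate hips Bs_pd alpha_ge1 ratio P_cvg Ts_mono c_gt0 cinf_gt0 c_cvg
    eps01 eps_cvg p_prox p_step Ts_zer BL zbar zz sub).
Qed.
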